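(* Suppose that $\mathcal C$ is a class of countable models (of a sentence in a countable language, closed under isomorphism) such that every $K\in\mathcal C$ has an elementary extension in $\mathcal C$ realizing a type which is not realized in $K$, and suppose $\mathcal C$ is closed under unions of countable elementary chains. Then $\mathcal C$ is not essentially countable, i.e. the isomorphism relation on the space of models in $\mathcal C$ with domain $\omega$ is not Borel bireducible with any countable Borel equivalence relation. *)

(* Defs.v *)
From HB Require Import structures.
From mathcomp Require Import all_boot all_order all_algebra.
From mathcomp Require Import all_classical all_reals all_analysis.
Set Implicit Arguments.
Unset Strict Implicit.
Unset Printing Implicit Defensive.
Local Open Scope classical_set_scope.

(* The language is countable because its sets of symbols are countTypes;
   constants are the function symbols of arity 0. *)
Record language := Language {
  funsym : countType;
  farity : funsym -> nat;
  relsym : countType;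
  rarity : relsym -> nat
}.

Record structure (L : language) := Structure {
  carrier :> Type;
  fint : forall f : funsym L, ('I_(farity f) -> carrier) -> carrier;
  rint : forall r : relsym L, ('I_(rarity r) -> carrier) -> bool
}.

Arguments fint {L} s f _.
Arguments rint {L} s r _.

(* [term L n] and [formula L n] are the terms and the L_{omega_1,omega}-formulas
   whose free variables are among x_0, ..., x_(n-1).  In [FEx], the bound
   variable is x_0 and the free variables are shifted by one. *)
Inductive term (L : language) (n : nat) : Type :=
| TVar of 'I_n
| TApp (f : funsym L) of ('I_(farity f) -> term L n).

Inductive formula (L : language) : nat -> Type :=
| FEq n of term L n & term L n : formula L n
| FRel n (r : relsym L) of ('I_(rarity r) -> term L n) : formula L n
| FNot n of formula L n : formula L n
| FAnd n of formula L n & formula L n : formula L n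
| FBigAnd n of (nat -> formula L n) : formula L n
| FEx n of formula L n.+1 : formula L n.

Definition sentence (L : language) := formula L 0.

Fixpoint first_order (L : language) (n : nat) (phi : formula L n) : Prop :=
  match phi with
  | FEq _ _ _ | FRel _ _ _ => True
  | FNot _ psi => first_order psi
  | FAnd _ psi1 psi2 => first_order psi1 /\ first_order psi2
  | FBigAnd _ _ => False
  | FEx _ psi => first_order psi
  end.

Definition env_cons (A : Type) (n : nat) (x : A) (a : 'I_n -> A) :
    'I_n.+1 -> A :=
  fun i => if unlift ord0 i is Some j then a j else x.

Fixpoint teval (L : language) (K : structure L) (n : nat) (a : 'I_n -> K)
    (t : term L n) : K :=
  match t with
  | TVar i => a i
  | TApp f ts => fint K f (fun i => teval a (ts i))
  end.

Fixpoint sat (L : language) (K : structure L) (n : nat) (phi : formula L n) :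
    ('I_n -> K) -> Prop :=
  match phi in formula _ m return ('I_m -> K) -> Prop with
  | FEq _ t u => fun a => teval a t = teval a u
  | FRel _ r ts => fun a => rint K r (fun i => teval a (ts i))
  | FNot _ psi => fun a => ~ sat psi a
  | FAnd _ psi1 psi2 => fun a => sat psi1 a /\ sat psi2 a
  | FBigAnd _ psi => fun a => forall k, sat (psi k) a
  | FEx _ psi => fun a => exists x : K, sat psi (env_cons x a)
  end.

Definition models (L : language) (K : structure L) (sigma : sentence L) : Prop :=
  forall a : 'I_0 -> K, sat sigma a.

Definition countable_model (L : language) (sigma : sentence L)
    (K : structure L) : Prop :=
  [/\ inhabited K, countable [set: K] & models K sigma].

Definition embedding (L : language) (K M : structure L) (h : K -> M) : Prop :=
  [/\ injective h,
      forall f a, h (fint K f a) = fint M f (h \o a) &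
      forall r a, rint K r a = rint M r (h \o a)].

Definition isomorphic (L : language) (K M : structure L) : Prop :=
  exists h : K -> M, embedding h /\ bijective h.

Definition elementary (L : language) (K M : structure L) (h : K -> M) : Prop :=
  forall (n : nat) (phi : formula L n), first_order phi ->
  forall a : 'I_n -> K, sat phi a <-> sat phi (h \o a).

Definition realizes (L : language) (K : structure L) (n : nat)
    (p : set (formula L n)) : Prop :=
  exists a : 'I_n -> K, forall phi, p phi -> sat phi a.

(* [p] ranges over the first-order n-types without parameters, given as sets of
   first-order formulas; consistency follows from being realized in [M]. *)
Definition realizes_new_type (L : language) (K M : structure L) : Prop :=
  exists (n : nat) (p : set (formula L n)),
    [/\ p `<=` @first_order L n, realizes M p & ~ realizes K p].

(* [M] is, up to isomorphism, the union of the chain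
   K 0 -> K 1 -> K 2 -> ... with transition maps [e]. *)
Definition is_chain_union (L : language) (K : nat -> structure L)
    (e : forall n, K n -> K n.+1) (M : structure L) : Prop :=
  exists j : forall n, K n -> M,
    [/\ forall n, embedding (j n),
        forall n x, j n.+1 (e n x) = j n x &
        forall y : M, exists n, exists x : K n, y = j n x].

Definition closed_under_isomorphism (L : language) (C : structure L -> Prop) :
    Prop :=
  forall K M, C K -> isomorphic K M -> C M.

Definition closed_under_elementary_chains (L : language)
    (C : structure L -> Prop) : Prop :=
  forall (K : nat -> structure L) (e : forall n, K n -> K n.+1)
    (M : structure L),
  (forall n, C (K n)) -> (forall n, elementary (e n)) ->
  is_chain_union e M -> C M.

(* nat and bool carry the discrete topology. *)
Definition model_space (L : language) : topologicalType :=
  (prod_topology (fun f : funsym L =>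
     prod_topology (fun _ : 'I_(farity f) -> nat => nat)) *
   prod_topology (fun r : relsym L =>
     prod_topology (fun _ : 'I_(rarity r) -> nat => bool)))%type.

Definition structure_of (L : language) (x : model_space L) : structure L :=
  @Structure L nat (fun f a => x.1 f a) (fun r a => x.2 r a).

Definition space_of (L : language) (C : structure L -> Prop) :
    set (model_space L) :=
  [set x | C (structure_of x)].

Definition iso_on (L : language) (C : structure L -> Prop)
    (x y : space_of C) : Prop :=
  isomorphic (structure_of (\val x)) (structure_of (\val y)).

Definition borel (T : topologicalType) : set (set T) := <<s @open T >>.

Definition borel_map (T U : topologicalType) (f : T -> U) : Prop :=
  forall B, borel B -> borel (f @^-1` B).

Definition borel_reducible (T U : topologicalType)
    (E : T -> T -> Prop) (F : U -> U -> Prop) : Prop :=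
  exists f : T -> U, borel_map f /\ forall x y, E x y <-> F (f x) (f y).

Definition borel_bireducible (T U : topologicalType)
    (E : T -> T -> Prop) (F : U -> U -> Prop) : Prop :=
  borel_reducible E F /\ borel_reducible F E.

Definition separable_space (T : topologicalType) : Prop :=
  exists2 D : set T, countable D & dense D.

(* A Hausdorff pseudometric space is a metric space. *)
Definition polish (R : realType) (Y : completePseudoMetricType R) : Prop :=
  hausdorff_space Y /\ separable_space Y.

Definition countable_borel_equivalence (T : topologicalType)
    (E : T -> T -> Prop) : Prop :=
  [/\ RelationClasses.Equivalence E,
      borel ([set p | E p.1 p.2] : set (T * T)%type) &
      forall x, countable [set y | E x y]].

Definition essentially_countable (R : realType) (T : topologicalType)
    (E : T -> T -> Prop) : Prop :=
  exists (Y : completePseudoMetricType R) (F : Y -> Y -> Prop),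
    [/\ polish Y, countable_borel_equivalence F & borel_bireducible E F].

(* Main.v *)
Require Import Defs.
From HB Require Import structures.
From mathcomp Require Import all_boot all_order all_algebra.
From mathcomp Require Import all_classical all_reals all_analysis.
From mathcomp Require Import lra.
Set Implicit Arguments.
Unset Strict Implicit.
Unset Printing Implicit Defensive.
Import Order.TTheory GRing.Theory Num.Theory.
Local Open Scope classical_set_scope.

(** Let f be a Borel reduction of isomorphism to F, all of whose classes are
    countable.  Force with pairs (x, p), where x is a model in C with universe
    nat, extended elementarily within C, and p is a finite injective sequence,
    an initial segment of a generic enumeration of x.  Closure under chains
    yields models x over which every relevant Borel statement about the
    enumerated copy of x is decided densely by the sequences p alone.
    The values of f on the copies of such an x lie in a single, countable
    F-class, so some p forces f to take a fixed value y: otherwise a generic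
    copy of x would avoid all members of the class.  Forcing persists to
    elementary extensions in C, hence p still forces the value y over a generic
    extension x2 of x that realizes a type omitted in x.  Then x and x2 have
    copies with the same image under f, so they are isomorphic, which is
    absurd.  Thus chains of length omega replace the usual chain of length
    omega_1 and the Vaught transforms. *)

(** * Elementary maps *)

Lemma env_cons0 (A : Type) (n : nat) (x : A) (a : 'I_n -> A) :
  env_cons x a ord0 = x.
Proof. by rewrite /env_cons unlift_none. Qed.

Lemma env_cons_lift (A : Type) (n : nat) (x : A) (a : 'I_n -> A) i :
  env_cons x a (lift ord0 i) = a i.
Proof. by rewrite /env_cons liftK. Qed.

Lemma comp_env_cons (A B : Type) (h : A -> B) (n : nat) (x : A)
    (a : 'I_n -> A) :
  h \o env_cons x a = env_cons (h x) (h \o a).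
Proof. by apply/funext => i; rewrite /env_cons /=; case: unlift. Qed.

Lemma finite_set_ord_surj (T : Type) : finite_set [set: T] ->
  exists n (a : 'I_n -> T), forall x, exists i, a i = x.
Proof.
move=> finT.
have /finite_seqP[s sT] : finite_set [set: {classic T}] by exact: finT.
exists (size s), (tnth (in_tuple s)) => x.
have /tnthP[i ->] : (x : {classic T}) \in in_tuple s.
  by have : [set` s] x by rewrite -sT.
by exists i.
Qed.

Section Elementary.
Variable L : language.
Implicit Types K M N : structure L.

Lemma embedding_comp K M N (h : K -> M) (k : M -> N) :
  embedding h -> embedding k -> embedding (k \o h).
Proof.
move=> [h_inj h_fun h_rel] [k_inj k_fun k_rel].
split=> [|f a|r a]; first exact: inj_comp.
- by rewrite /= h_fun k_fun.
- by rewrite h_rel k_rel.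
Qed.

Lemma isomorphic_refl K : isomorphic K K.
Proof. by exists id; split; [split | exists id]. Qed.

Lemma isomorphic_sym K M : isomorphic K M -> isomorphic M K.
Proof.
move=> [h [[h_inj h_fun h_rel] [k hK kK]]]; exists k.
have compK m (a : 'I_m -> M) : h \o (k \o a) = a by apply/funext => i /=.
split; last by exists h.
split=> [|f a|r a]; first exact: can_inj kK.
- by apply: h_inj; rewrite kK h_fun compK.
- by rewrite h_rel compK.
Qed.

Lemma teval_embedding K M (h : K -> M) n (a : 'I_n -> K) (t : term L n) :
  embedding h -> teval (h \o a) t = h (teval a t).
Proof.
move=> [_ h_fun _]; elim: t => [i|f ts IH] //=.
by rewrite h_fun; congr (fint M f _); apply/funext => i /=.
Qed.

Lemma comp_teval_embedding K M (h : K -> M) n m (a : 'I_n -> K)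
    (ts : 'I_m -> term L n) :
  embedding h ->
  h \o (fun i => teval a (ts i)) = (fun i => teval (h \o a) (ts i)).
Proof. by move=> h_emb; apply/funext => i /=; rewrite teval_embedding. Qed.

Lemma sat_isomorphism K M (h : K -> M) n (phi : formula L n) (a : 'I_n -> K) :
  embedding h -> bijective h -> sat phi a <-> sat phi (h \o a).
Proof.
move=> h_emb [h' hK h'K]; have [h_inj _ h_rel] := h_emb.
elim: phi a =>
  {n} [n t u|n r ts|n phi IH|n phi1 IH1 phi2 IH2|n phis IH|n phi IH] a /=.
- rewrite !teval_embedding //; split=> [->//|]; exact: h_inj.
- by rewrite h_rel comp_teval_embedding.
- by rewrite IH.
- by rewrite IH1 IH2.
- by split=> phis_sat k; apply/IH; exact: phis_sat.
- split=> [[x]|[y]].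
    by move=> /IH; rewrite comp_env_cons; exists (h x).
  by rewrite -(h'K y) -comp_env_cons => /IH; exists (h' y).
Qed.

Lemma elementary_isomorphism K M (h : K -> M) :
  embedding h -> bijective h -> elementary h.
Proof. by move=> h_emb h_bij n phi _ a; exact: sat_isomorphism. Qed.

Lemma isomorphic_elementary K M :
  isomorphic K M -> exists h : K -> M, elementary h.
Proof.
by move=> [h [h_emb h_bij]]; exists h; exact: elementary_isomorphism.
Qed.

Lemma elementary_id K : elementary (@id K).
Proof. by []. Qed.

Lemma elementary_comp K M N (h : K -> M) (k : M -> N) :
  elementary h -> elementary k -> elementary (k \o h).
Proof.
move=> h_el k_el n phi phi_fo a.
by rewrite (h_el _ _ phi_fo) (k_el _ _ phi_fo) compA.
Qed.

Lemma elementary_embedding K M (h : K -> M) : elementary h -> embedding h.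
Proof.
move=> h_el; split.
- move=> x y hxy.
  have := h_el 2 (FEq (TVar L ord0) (TVar L (lift ord0 ord0))) I
    (env_cons x (env_cons y (fun _ => x))).
  rewrite /= !env_cons_lift !env_cons0 => -[_]; exact.
- move=> f a.
  have := h_el _ (FEq (TVar L ord0) (TApp (fun i => TVar L (lift ord0 i)))) I
    (env_cons (fint K f a) a).
  rewrite comp_env_cons /= !env_cons0.
  have env_consK (N : structure L) x (b : 'I_(farity f) -> N) :
      (fun i => env_cons x b (lift ord0 i)) = b.
    by apply/funext => i; rewrite env_cons_lift.
  by rewrite !env_consK => -[+ _]; apply.
- move=> r a.
  have /= rel_iff := h_el _ (FRel (fun i => TVar L i)) I a.
  by apply/idP/idP => /rel_iff.
Qed.

Lemma elementary_inj K M (h : K -> M) : elementary h -> injective h.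
Proof. by move=> /elementary_embedding[]. Qed.

Lemma realizes_elementary K M (h : K -> M) n (p : set (formula L n)) :
  p `<=` @first_order L n -> elementary h -> realizes K p -> realizes M p.
Proof.
move=> p_fo h_el [a a_real]; exists (h \o a) => phi pphi.
by apply/h_el; [exact: p_fo|exact: a_real].
Qed.

Lemma realizes_new_type_elementary K K' M M' (h : K' -> K) (k : M -> M') :
  elementary h -> elementary k ->
  realizes_new_type K M -> realizes_new_type K' M'.
Proof.
move=> h_el k_el [n [p [p_fo M_real K_omit]]]; exists n, p; split=> //.
  exact: realizes_elementary k_el M_real.
by move=> /(realizes_elementary p_fo h_el).
Qed.

Lemma elementary_surj_no_new_type K M (h : K -> M) :
  elementary h -> (forall y, exists x, h x = y) -> ~ realizes_new_type K M.
Proof.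
move=> h_el h_surj [n [p [p_fo [b b_real] K_omit]]]; apply: K_omit.
have /choice[a ha] := fun i => h_surj (b i).
exists a => phi pphi; apply/(h_el _ phi (p_fo _ pphi)).
by have -> : h \o a = b; [exact/funext|exact: b_real].
Qed.

Lemma isomorphic_no_new_type K M : isomorphic K M -> ~ realizes_new_type K M.
Proof.
move=> [h [h_emb [k hK kK]]].
apply: (@elementary_surj_no_new_type _ _ h); last by move=> y; exists (k y).
by apply: elementary_isomorphism => //; exists k.
Qed.

Definition fresh_formula n : formula L n.+1 :=
  foldr (fun i => FAnd (FNot (FEq (TVar L ord0) (TVar L (lift ord0 i)))))
    (FEq (TVar L ord0) (TVar L ord0)) (enum 'I_n).

Lemma first_order_fresh_formula n : first_order (fresh_formula n).
Proof. by rewrite /fresh_formula; elim: (enum 'I_n). Qed.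

Lemma sat_fresh_formula K n (a : 'I_n -> K) x :
  sat (fresh_formula n) (env_cons x a) <-> forall i, x <> a i.
Proof.
have -> : (forall i, x <> a i) <-> (forall i, i \in enum 'I_n -> x <> a i).
  by split=> x_fresh i => [_|]; apply: x_fresh; rewrite ?mem_enum.
rewrite /fresh_formula; elim: (enum 'I_n) => [|i s IH] //=.
rewrite env_cons0 env_cons_lift IH; split.
  by move=> [xi x_fresh] j; rewrite in_cons => /orP[/eqP ->|/x_fresh].
move=> x_fresh; split; first by apply: x_fresh; exact: mem_head.
by move=> j js; apply: x_fresh; rewrite in_cons js orbT.
Qed.

Lemma elementary_finite_surj K M (h : K -> M) :
  elementary h -> finite_set [set: K] -> forall y, exists x, h x = y.
Proof.
move=> h_el /finite_set_ord_surj[n [a a_surj]] y.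
apply: contrapT => y_new.
have [_] := h_el _ (FEx (fresh_formula n)) (first_order_fresh_formula n) a.
case.
  by exists y; apply/sat_fresh_formula => i y_eq; apply: y_new; exists (a i).
by move=> x /sat_fresh_formula x_fresh; have [i /esym /x_fresh] := a_surj x.
Qed.

End Elementary.

(** * Unions of elementary chains *)

Section ChainUnion.
Variables (L : language) (K : nat -> structure L).
Variable e : forall n, K n -> K n.+1.
Arguments e : clear implicits.
Hypothesis e_elementary : forall n, elementary (e n).

Lemma chain_elementary_map (U : Type) (j : forall n, K n -> U) :
  (forall n x, j n.+1 (e n x) = j n x) ->
  forall n m, (n <= m)%N ->
  exists h : K n -> K m, elementary h /\ forall x, j m (h x) = j n x.
Proof.
move=> je n; elim=> [|m IH].
  by rewrite leqn0 => /eqP ->; exists id; split; first exact: elementary_id.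
rewrite leq_eqVlt => /orP[/eqP ->|].
  by exists id; split; first exact: elementary_id.
rewrite ltnS => /IH[h [h_el jh]]; exists (e m \o h); split.
  exact: elementary_comp h_el (@e_elementary m).
by move=> x /=; rewrite je jh.
Qed.

Lemma chain_common_level (I : finType) (U : Type) (j : forall n, K n -> U) :
  (forall n x, j n.+1 (e n x) = j n x) ->
  forall u : I -> U, (forall i, exists n (x : K n), u i = j n x) ->
  exists n (b : I -> K n), u = @j n \o b.
Proof.
move=> je u /choice[n u_level]; exists (\max_i n i).
suff /choice[b jb] : forall i, exists y : K (\max_i n i), j _ y = u i.
  by exists b; apply/funext => i /=; rewrite jb.
move=> i; have [x ->] := u_level i.
have [h [_ jh]] := chain_elementary_map je (leq_bigmax (F := n) i).
by exists (h x).
Qed.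

Lemma elementary_chain_union (M : structure L) (j : forall n, K n -> M) :
  (forall n, embedding (j n)) ->
  (forall n x, j n.+1 (e n x) = j n x) ->
  (forall y : M, exists n, exists x : K n, y = j n x) ->
  forall n, elementary (j n).
Proof.
move=> j_emb je j_surj n k phi.
elim: phi n =>
  {k} [k t u|k r ts|k phi IH|k phi1 IH1 phi2 IH2|k phis IH|k phi IH] n /=.
- move=> _ a; rewrite !teval_embedding //; split=> [->//|].
  by have [j_inj _ _] := j_emb n; exact: j_inj.
- by move=> _ a; have [_ _ ->] := j_emb n; rewrite comp_teval_embedding.
- by move=> phi_fo a; rewrite (IH n).
- by move=> [phi1_fo phi2_fo] a; rewrite (IH1 n) // (IH2 n).
- by [].
- move=> phi_fo a; split=> [[x]|[y]].
    by move=> /(IH n phi_fo); rewrite comp_env_cons; exists (j n x).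
  have [m [x ->]] := j_surj y.
  have [h [h_el jh]] := chain_elementary_map je (leq_maxl n m).
  have [h' [h'_el jh']] := chain_elementary_map je (leq_maxr n m).
  rewrite -jh'; have -> : j n \o a = j (maxn n m) \o (h \o a).
    by apply/funext => i /=; rewrite jh.
  rewrite -comp_env_cons => /IH - /(_ phi_fo) sat_phi.
  by apply/(h_el k (FEx phi) phi_fo a); exists (h' x).
Qed.

Lemma is_chain_union_isomorphic (M N : structure L) :
  is_chain_union e M -> isomorphic M N -> is_chain_union e N.
Proof.
move=> [j [j_emb je j_surj]] [h [h_emb [h' hK h'K]]].
exists (fun n => h \o j n); split=> [n|n x|y].
- exact: embedding_comp.
- by rewrite /= je.
- have [n [x jx]] := j_surj (h' y).
  by exists n, x; rewrite /= -jx h'K.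
Qed.

(* An element of the union is named by the least level at which it appears,
   together with its value there. *)
Fixpoint chain_name n : K n -> {m & K m} :=
  match n return K n -> {m & K m} with
  | 0 => fun x => Tagged K x
  | m.+1 => fun x =>
      if pselect (exists y, e m y = x) is left x_old
      then chain_name (sval (cid x_old)) else Tagged K x
  end.

Lemma chain_nameS n (x : K n) : chain_name (e n x) = chain_name x.
Proof.
rewrite /=; case: pselect => [x_old|[]]; last by exists x.
by case: cid => y /= /(elementary_inj (@e_elementary n)) ->.
Qed.

Lemma tag_chain_name_le n (x : K n) : (tag (chain_name x) <= n)%N.
Proof.
elim: n x => [|n IH] x //=; case: pselect => [x_old|//].
exact: leq_trans (IH _) _.
Qed.

Lemma chain_name_inj n : injective (@chain_name n).
Proof.
elim: n => [|n IH] x y /=; first exact: eq_from_Tagged.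
case: pselect => x_old; case: pselect => y_old.
- by case: cid => x' /= <-; case: cid => y' /= <- /IH ->.
- move=> eq_name; have := tag_chain_name_le (sval (cid x_old)).
  by rewrite eq_name ltnn.
- move=> eq_name; have := tag_chain_name_le (sval (cid y_old)).
  by rewrite -eq_name ltnn.
- exact: eq_from_Tagged.
Qed.

Definition limit_carrier : Type :=
  {u : {m & K m} | exists n (x : K n), chain_name x = u}.

Definition limit_inj n (x : K n) : limit_carrier :=
  exist _ (chain_name x) (ex_intro _ n (ex_intro _ x erefl)).

Lemma limit_injS n (x : K n) : limit_inj (e n x) = limit_inj x.
Proof. exact/eq_exist/chain_nameS. Qed.

Lemma limit_inj_inj n : injective (@limit_inj n).
Proof. by move=> x y /(congr1 sval) /chain_name_inj. Qed.

Lemma limit_inj_surj (u : limit_carrier) : exists n (x : K n), u = limit_inj x.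
Proof.
case: u => u u_name; have [n [x xu]] := u_name.
by exists n, x; exact: eq_exist.
Qed.

Lemma limit_tuple r (a : 'I_r -> limit_carrier) :
  exists n (b : 'I_r -> K n), a = @limit_inj n \o b.
Proof.
by apply: (chain_common_level limit_injS) => i; exact: limit_inj_surj.
Qed.

Lemma limit_tuple_map r n m (b : 'I_r -> K n) (c : 'I_r -> K m) :
  (n <= m)%N -> @limit_inj n \o b = @limit_inj m \o c ->
  exists h : K n -> K m,
    [/\ embedding h, forall x, limit_inj (h x) = limit_inj x & c = h \o b].
Proof.
move=> /(chain_elementary_map limit_injS)[h [h_el jh]] eq_bc; exists h.
split=> //; first exact: elementary_embedding.
apply/funext => i; apply: limit_inj_inj; rewrite /= jh.
by have := congr1 (@^~ i) eq_bc.
Qed.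

Definition limit_level r (a : 'I_r -> limit_carrier) := cid (limit_tuple a).

Definition limit_coord r (a : 'I_r -> limit_carrier) :=
  cid (projT2 (limit_level a)).

Definition limit_structure : structure L :=
  @Structure L limit_carrier
    (fun f a => limit_inj (fint (K (projT1 (limit_level a))) f
                            (projT1 (limit_coord a))))
    (fun r a => rint (K (projT1 (limit_level a))) r (projT1 (limit_coord a))).

Lemma limit_inj_fint f n m
    (b : 'I_(farity f) -> K n) (c : 'I_(farity f) -> K m) :
  @limit_inj n \o b = @limit_inj m \o c ->
  limit_inj (fint (K n) f b) = limit_inj (fint (K m) f c).
Proof.
move=> eq_bc; have [nm|/ltnW mn] := leqP n m.
  have [h [[_ h_fun _] jh ->]] := limit_tuple_map nm eq_bc.
  by rewrite -h_fun jh.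
have [h [[_ h_fun _] jh ->]] := limit_tuple_map mn (esym eq_bc).
by rewrite -h_fun jh.
Qed.

Lemma limit_inj_rint r n m
    (b : 'I_(rarity r) -> K n) (c : 'I_(rarity r) -> K m) :
  @limit_inj n \o b = @limit_inj m \o c -> rint (K n) r b = rint (K m) r c.
Proof.
move=> eq_bc; have [nm|/ltnW mn] := leqP n m.
  by have [h [[_ _ h_rel] _ ->]] := limit_tuple_map nm eq_bc.
by have [h [[_ _ h_rel] _ ->]] := limit_tuple_map mn (esym eq_bc).
Qed.

Lemma limit_inj_embedding n : embedding (@limit_inj n : K n -> limit_structure).
Proof.
split; first exact: limit_inj_inj.
- by move=> f a; apply: limit_inj_fint; exact: projT2 (limit_coord _).
- by move=> r a; apply: limit_inj_rint; exact: projT2 (limit_coord _).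
Qed.

Lemma chain_union_exists : exists M : structure L, is_chain_union e M.
Proof.
exists limit_structure, limit_inj; split.
- exact: limit_inj_embedding.
- exact: limit_injS.
- exact: limit_inj_surj.
Qed.

End ChainUnion.

(** * Models with universe nat *)

Definition nat_copy (L : language) (K : structure L) (g : nat -> K)
    (g' : K -> nat) : model_space L :=
  (fun f a => g' (fint K f (g \o a)), fun r a => rint K r (g \o a)).

Lemma nat_copy_isomorphic (L : language) (K : structure L) (g : nat -> K)
    (g' : K -> nat) :
  cancel g g' -> cancel g' g -> isomorphic (structure_of (nat_copy g g')) K.
Proof.
move=> gK g'K; exists g; split; last by exists g'.
by split=> [|f a|r a]; [exact: can_inj gK|exact: g'K|].
Qed.

Lemma countable_infinite_bij_nat (T : Type) :
  countable [set: T] -> infinite_set [set: T] ->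
  exists f : T -> nat, bijective f.
Proof.
move=> T_countable T_infinite.
have /card_set_bijP[f f_bij] := eq_card_nat T_countable T_infinite.
by exists f; rewrite -setTT_bijective.
Qed.

Lemma nat_copy_exists (L : language) (K : structure L) :
  countable [set: K] -> infinite_set [set: K] ->
  exists x : model_space L, isomorphic K (structure_of x).
Proof.
move=> K_countable K_infinite.
have [g' [g g'K gK]] := countable_infinite_bij_nat K_countable K_infinite.
exists (nat_copy g g'); exact: isomorphic_sym (nat_copy_isomorphic gK g'K).
Qed.

Definition iso_class (L : language) (x : model_space L) :
    set (model_space L) :=
  [set y | isomorphic (structure_of y) (structure_of x)].

Definition isomorphism_invariant (L : language) (P : set (model_space L)) :
    Prop :=
  forall x, P x -> iso_class x `<=` P.

Definition closed_under_nat_chains (L : language) (P : set (model_space L)) :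
    Prop :=
  forall (xs : nat -> model_space L)
    (e : forall n, structure_of (xs n) -> structure_of (xs n.+1)),
  (forall n, P (xs n)) -> (forall n, elementary (e n)) ->
  exists2 y, P y & is_chain_union e (structure_of y).

Definition type_extendible (L : language) (P : set (model_space L)) : Prop :=
  forall x, P x -> exists y,
    [/\ P y, exists h : structure_of x -> structure_of y, elementary h &
        realizes_new_type (structure_of x) (structure_of y)].

Section NatModels.
Variables (L : language) (sigma : sentence L) (C : structure L -> Prop).
Hypothesis C_models : forall K, C K -> countable_model sigma K.
Hypothesis C_iso : closed_under_isomorphism C.
Hypothesis C_ext : forall K, C K ->
  exists M : structure L,
    [/\ C M, exists h : K -> M, elementary h & realizes_new_type K M].
Hypothesis C_chains : closed_under_elementary_chains C.

Lemma space_of_isomorphism_invariant : isomorphism_invariant (space_of C).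
Proof. by move=> x Cx y /isomorphic_sym; exact: C_iso Cx. Qed.

Lemma class_infinite K : C K -> infinite_set [set: K].
Proof.
move=> /C_ext[M [_ [h h_el] new_type]] /(elementary_finite_surj h_el) h_surj.
exact: (elementary_surj_no_new_type h_el h_surj).
Qed.

Lemma class_nat_copy K : C K ->
  exists2 x, space_of C x & isomorphic K (structure_of x).
Proof.
move=> CK; have [_ K_countable _] := C_models CK.
have [x Kx] := nat_copy_exists K_countable (class_infinite CK).
by exists x => //; exact: C_iso CK Kx.
Qed.

Lemma space_of_type_extendible : type_extendible (space_of C).
Proof.
move=> x /C_ext[M [CM [h h_el] new_type]].
have [y Cy /isomorphic_elementary[k k_el]] := class_nat_copy CM.
exists y; split=> //; first by exists (k \o h); exact: elementary_comp.
exact: realizes_new_type_elementary (@elementary_id _ _) k_el new_type.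
Qed.

Lemma space_of_closed_under_nat_chains : closed_under_nat_chains (space_of C).
Proof.
move=> xs e Cxs e_el; have [M M_union] := chain_union_exists e_el.
have [y Cy My] := class_nat_copy (C_chains Cxs e_el M_union).
by exists y => //; exact: is_chain_union_isomorphic M_union My.
Qed.

End NatModels.

(** * Generic sequences *)

Lemma countableU (T : Type) (A B : set T) :
  countable A -> countable B -> countable (A `|` B).
Proof.
move=> A_countable B_countable; rewrite -bigcup2E.
by apply: bigcup_countable => // -[|[|n]] _ //=; exact: countable0.
Qed.

Lemma countable_image (T U : Type) (f : T -> U) (A : set T) :
  countable A -> countable (f @` A).
Proof. exact: sub_countable (card_image_le _ _). Qed.

Definition cofinal (T : Type) (A : set T) (le : T -> T -> Prop) (E : set T) :
    Prop :=
  forall q, A q -> exists r, [/\ A r, le q r & E r].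

Lemma rasiowa_sikorski (T : Type) (A : set T) (le : T -> T -> Prop)
    (D : set (set T)) (p : T) :
  (forall q, A q -> le q q) -> countable D -> D `<=` cofinal A le -> A p ->
  exists s : nat -> T,
    [/\ s 0%N = p, forall n, A (s n), forall n, le (s n) (s n.+1) &
        forall E, D E -> exists n, E (s n)].
Proof.
move=> le_refl /ocard_geP[d] D_cofinal Ap.
have /choice[next nextP] : forall nq : nat * T, exists r, A nq.2 ->
    [/\ A r, le nq.2 r & forall E, D E -> d nq.1 = Some E -> E r].
  move=> [n q] /=; have [Aq|nAq] := pselect (A q); last by exists q.
  have [[E [DE dn]]|no_task] := pselect (exists E, D E /\ d n = Some E).
    have [r [Ar qr Er]] := D_cofinal E DE q Aq.
    by exists r => _; split=> // E' _; rewrite dn => -[<-].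
  exists q => _; split=> //; first exact: le_refl.
  by move=> E DE dn; case: no_task; exists E.
pose s := fix s n := if n is m.+1 then next (m, s m) else p.
have As n : A (s n) by elim: n => [|n IH] //=; have [] := nextP (n, s n) IH.
exists s; split=> // [n|E DE]; first by have [] := nextP (n, s n) (As n).
have [n _ dn] := @surj _ _ _ _ d (Some E) (imageP Some DE).
by exists n.+1; have [_ _] := nextP (n, s n) (As n); exact.
Qed.

Section PrefixChain.
Variable s : nat -> seq nat.
Hypothesis s_uniq : forall n, uniq (s n).
Hypothesis s_prefix : forall n, prefix (s n) (s n.+1).
Hypothesis s_cover : forall k, exists n, k \in s n.

Lemma prefix_chain_homo : {homo s : n m / (n <= m)%N >-> prefix n m}.
Proof.
by apply: homo_leq => // [|p q r]; [exact: prefix_refl|exact: prefix_trans].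
Qed.

Lemma prefix_chain_size k : exists n, (k < size (s n))%N.
Proof.
have /choice[lvl lvlP] := s_cover.
exists (\max_(i < k.+1) lvl i).
apply: (@leq_trans (size (iota 0 k.+1))); first by rewrite size_iota.
apply: uniq_leq_size; first exact: iota_uniq.
move=> i; rewrite mem_iota add0n => /= ik.
have le_lvl : (lvl i <= \max_(j < k.+1) lvl j)%N.
  exact: (leq_bigmax (F := fun j : 'I_k.+1 => lvl j) (Ordinal ik)).
by have /prefixP[r ->] := prefix_chain_homo le_lvl; rewrite mem_cat lvlP.
Qed.

Lemma nth_prefix_chain n m k :
  (k < size (s n))%N -> (k < size (s m))%N ->
  nth 0%N (s n) k = nth 0%N (s m) k.
Proof.
wlog nm : n m / (n <= m)%N => [wlog_le kn km|kn _].
  have [/wlog_le|/ltnW/wlog_le nth_sym] := leqP n m; first exact.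
  exact/esym/nth_sym.
by have /prefixP[r ->] := prefix_chain_homo nm; rewrite nth_cat kn.
Qed.

Lemma prefix_chain_bijection : exists g g' : nat -> nat,
  [/\ cancel g g', cancel g' g & forall n, s n = mkseq g (size (s n))].
Proof.
have /choice[lvl lvlP] := prefix_chain_size.
pose g k := nth 0%N (s (lvl k)) k.
have sE n : s n = mkseq g (size (s n)).
  apply: (@eq_from_nth _ 0%N) => [|k kn]; first by rewrite size_mkseq.
  by rewrite nth_mkseq //; exact: nth_prefix_chain.
have g_inj : injective g.
  move=> a b; have abn := lvlP (maxn a b); set n := lvl _ in abn.
  have := s_uniq n; rewrite sE => /(uniqP 0%N) - /(_ a b).
  by rewrite !inE size_mkseq !nth_mkseq ?(leq_ltn_trans _ abn) ?leq_maxl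
    ?leq_maxr//; exact.
have /choice[g' g'K] : forall k, exists i, g i = k.
  by move=> k; have [n] := s_cover k; rewrite sE => /mapP[i _ ->]; exists i.
by exists g, g'; split=> // k; exact: g_inj.
Qed.

End PrefixChain.

Definition injective_cofinal : set (seq nat) -> Prop :=
  cofinal [set q | uniq q] (fun q r => prefix q r).

Lemma mem_injective_cofinal k : injective_cofinal [set q | k \in q].
Proof.
move=> q /= q_uniq; have [kq|kq] := boolP (k \in q).
  by exists q; rewrite prefix_refl.
by exists (rcons q k); rewrite rcons_uniq kq prefix_rcons mem_rcons mem_head.
Qed.

Lemma generic_bijection (D : set (set (seq nat))) (p : seq nat) :
  countable D -> D `<=` injective_cofinal -> uniq p ->
  exists g g' : nat -> nat,
    [/\ cancel g g', cancel g' g, mkseq g (size p) = p &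
        forall E, D E -> exists m, E (mkseq g m)].
Proof.
move=> D_countable D_cofinal p_uniq.
pose covering := range (fun k : nat => [set q : seq nat | k \in q]).
have [||||s [s0 s_uniq s_prefix s_meets]] :=
  @rasiowa_sikorski _ [set q | uniq q] (fun q r => prefix q r)
    (D `|` covering) p; [| |move=> E [/D_cofinal|[k _ <-]] //|by []|].
- by move=> q _; exact: prefix_refl.
- by apply: countableU => //; exact: countable_image.
- exact: mem_injective_cofinal.
have s_cover k : exists n, k \in s n.
  by apply: (s_meets [set q | k \in q]); right; exists k.
have [g [g' [gK g'K sE]]] := prefix_chain_bijection s_uniq s_prefix s_cover.
exists g, g'; split=> //; first by rewrite -s0 -sE.
move=> E DE; have [n] := s_meets E (or_introl DE).
by rewrite sE; exists (size (s n)).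
Qed.

(** * Borel codes *)

Lemma cvg_prod_topology (I J : Type) (T : I -> topologicalType)
    (F : set_system J) (u : J -> prod_topology T) (l : prod_topology T) :
  Filter F -> (forall i, u n i @[n --> F] --> l i) -> u @ F --> l.
Proof.
move=> F_filter ul; apply/cvg_sup => i A [_ [[B B_open <-] Bl BA]].
by apply: filterS BA _; apply: (ul i); exact: open_nbhs_nbhs.
Qed.

Section BorelCodes.
Variable L : language.
Implicit Types x y : model_space L.

Definition coordinate : countType :=
  ({f : funsym L & (farity f).-tuple nat} +
   {r : relsym L & (rarity r).-tuple nat})%type.

Definition coord_val x (i : coordinate) : nat :=
  match i with
  | inl (existT f t) => x.1 f (tnth t)
  | inr (existT r t) => x.2 r (tnth t)
  end.

Lemma coord_val_fun x f (a : 'I_(farity f) -> nat) :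
  coord_val x (inl (existT _ f (mktuple a))) = x.1 f a.
Proof. by congr (x.1 f _); apply/funext => k; rewrite tnth_mktuple. Qed.

Lemma coord_val_rel x r (a : 'I_(rarity r) -> nat) :
  coord_val x (inr (existT _ r (mktuple a))) = x.2 r a.
Proof.
by congr (nat_of_bool (x.2 r _)); apply/funext => k; rewrite tnth_mktuple.
Qed.

Lemma cvg_model_space (J : Type) (F : set_system J) (u : J -> model_space L) x :
  Filter F ->
  (forall i, \forall n \near F, coord_val (u n) i = coord_val x i) ->
  u @ F --> x.
Proof.
move=> F_filter ux.
have u1x1 : (fun n => (u n).1) @ F --> x.1.
  apply: cvg_prod_topology => f; apply: cvg_prod_topology => a.
  apply: cvg_near_cst; have := ux (inl (existT _ f (mktuple a))).
  by apply: filterS => n; rewrite !coord_val_fun.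
have u2x2 : (fun n => (u n).2) @ F --> x.2.
  apply: cvg_prod_topology => r; apply: cvg_prod_topology => a.
  apply: cvg_near_cst; have := ux (inr (existT _ r (mktuple a))).
  by apply: filterS => n; rewrite !coord_val_rel => /(can_inj oddb).
move=> A xA.
have pair_A : \forall n \near F, A ((u n).1, (u n).2).
  exact: (cvg_pair u1x1 u2x2 xA).
by apply: filterS pair_A => n; rewrite -surjective_pairing.
Qed.

Definition cylinder (s : seq (coordinate * nat)) : set (model_space L) :=
  \bigcap_(a in [set` s]) [set x | coord_val x a.1 = a.2].

Lemma open_cylinder (O : set (model_space L)) x :
  open O -> O x -> exists2 s, cylinder s x & cylinder s `<=` O.
Proof.
move=> O_open Ox; apply: contrapT => no_cylinder.
pose agree n : seq (coordinate * nat) :=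
  [seq (i, coord_val x i) | i <- pmap unpickle (iota 0 n)].
have agree_x n : cylinder (agree n) x by move=> _ /= /mapP[i _ ->].
have /choice[u uP] n : exists y, cylinder (agree n) y /\ ~ O y.
  apply: contrapT => no_y; apply: no_cylinder; exists (agree n) => // y y_agree.
  by apply: contrapT => nOy; apply: no_y; exists y.
have : u @ \oo --> x.
  apply: cvg_model_space => i; exists (pickle i).+1 => // n /= i_lt_n.
  have [u_agree _] := uP n; apply: (u_agree (i, coord_val x i)).
  apply: map_f; rewrite mem_pmap; apply/mapP; exists (pickle i).
    by rewrite mem_iota.
  by rewrite pickleK.
move=> /(_ O (open_nbhs_nbhs (conj O_open Ox)))[n _ uO].
by have [_] := uP n; apply; apply: uO => /=.
Qed.

Inductive borel_code :=
| CEmpty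
| CAtom of coordinate & nat
| CNot of borel_code
| CUnion of (nat -> borel_code).

Fixpoint denote (c : borel_code) : set (model_space L) :=
  match c with
  | CEmpty => set0
  | CAtom i m => [set x | coord_val x i = m]
  | CNot b => ~` denote b
  | CUnion bs => \bigcup_n denote (bs n)
  end.

Definition coded (A : set (model_space L)) : Prop := exists c, denote c = A.

Lemma codedC A : coded A -> coded (~` A).
Proof. by move=> [c <-]; exists (CNot c). Qed.

Lemma coded_bigcup (I : countType) (D : set I) (A : I -> set (model_space L)) :
  (forall i, D i -> coded (A i)) -> coded (\bigcup_(i in D) A i).
Proof.
move=> A_coded.
have /choice[c cA] n : exists c,
    denote c = \bigcup_(i in D `&` [set i | unpickle n = Some i]) A i.
  case: (unpickle n) => [i|]; last first.
    by exists CEmpty; apply/esym/bigcup0 => j [].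
  have [Di|nDi] := pselect (D i).
    have [c cA] := A_coded i Di; exists c; rewrite cA.
    by apply/seteqP; split=> [x Ax|x [j [_ [<-]]] //]; exists i.
  by exists CEmpty; apply/esym/bigcup0 => j [Dj [ij]]; rewrite ij in nDi.
exists (CUnion c); apply/seteqP; split=> x /=.
  by move=> [n _]; rewrite cA => -[i [Di _] Ax]; exists i.
move=> [i Di Ax]; exists (pickle i) => //; rewrite cA.
by exists i => //=; rewrite pickleK.
Qed.

Lemma coded_cylinder s : coded (cylinder s).
Proof.
rewrite -[cylinder s]setCK; apply: codedC; rewrite setC_bigcap.
by apply: coded_bigcup => a _; apply: codedC; exists (CAtom a.1 a.2).
Qed.

Lemma coded_open (O : set (model_space L)) : open O -> coded O.
Proof.
move=> O_open.
have -> : O = \bigcup_(s in [set s | cylinder s `<=` O]) cylinder s.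
  apply/seteqP; split=> [x Ox|x [s sO /sO //]].
  by have [s sx sO] := open_cylinder O_open Ox; exists s.
by apply: coded_bigcup => s _; exact: coded_cylinder.
Qed.

Lemma borel_coded (X : set (model_space L)) (A : set X) :
  borel A -> exists c, A = [set z | denote c (\val z)].
Proof.
pose traces : set (set X) :=
  [set A | exists c, A = [set z | denote c (\val z)]].
suff : <<s @open X >> `<=` traces by apply.
apply: smallest_sub; last first.
  by move=> _ [V /coded_open[c <-] <-]; exists c; rewrite set_valE.
split.
- by exists CEmpty.
- by move=> _ [c ->]; exists (CNot c); rewrite setTD.
- move=> B /choice[c Bc]; exists (CUnion c).
  by rewrite (eq_bigcupr (fun n _ => Bc n)).
Qed.

Fixpoint negated_subcodes (c : borel_code) : set borel_code :=
  match c with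
  | CEmpty | CAtom _ _ => set0
  | CNot b => b |` negated_subcodes b
  | CUnion bs => \bigcup_n negated_subcodes (bs n)
  end.

Lemma countable_negated_subcodes c : countable (negated_subcodes c).
Proof.
elim: c => [|i m|b IH|bs IH] /=; [exact: countable0|exact: countable0| |].
  by apply: countableU => //; exact: countable1.
by apply: bigcup_countable => // n _; exact: IH.
Qed.

End BorelCodes.

Arguments CEmpty {L}.

(** * Forcing *)

Lemma prefix_mkseq (T : eqType) (g : nat -> T) n m :
  (n <= m)%N -> prefix (mkseq g n) (mkseq g m).
Proof.
move=> nm; rewrite prefixE size_mkseq /mkseq -map_take take_iota.
by rewrite (minn_idPl nm).
Qed.

Lemma prefix_map (T U : eqType) (h : T -> U) (p q : seq T) :
  prefix p q -> prefix (map h p) (map h q).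
Proof. by move=> /prefixP[r ->]; rewrite map_cat prefix_prefix. Qed.

Section Forcing.
Variable L : language.
Implicit Types (x y z : model_space L) (p q : seq nat).

(* The finite sequence p is the initial segment of an enumeration g of x; the
   forced statements concern the copy of x with universe nat induced by g. *)
Definition forces_atom x p (i : coordinate L) (m : nat) : Prop :=
  match i with
  | inl (existT f t) =>
      [/\ forall k, (tnth t k < size p)%N, (m < size p)%N &
          x.1 f (fun k => nth 0%N p (tnth t k)) = nth 0%N p m]
  | inr (existT r t) =>
      (forall k, (tnth t k < size p)%N) /\
      (x.2 r (fun k => nth 0%N p (tnth t k)) : nat) = m
  end.

Lemma coord_val_nat_copy_forces x (g g' : nat -> nat) i m :
  cancel g g' -> cancel g' g ->
  coord_val (@nat_copy L (structure_of x) g g') i = m <->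
  exists n, forces_atom x (mkseq g n) i m.
Proof.
move=> gK g'K.
have tuple_bound r (t : r.-tuple nat) : exists n, forall k, (tnth t k < n)%N.
  exists (\max_k tnth t k).+1 => k; rewrite ltnS.
  exact: (leq_bigmax (F := fun k => tnth t k)).
have nth_tuple n r (t : r.-tuple nat) : (forall k, (tnth t k < n)%N) ->
    (fun k => nth 0%N (mkseq g n) (tnth t k)) = g \o tnth t.
  by move=> tn; apply/funext => k; rewrite nth_mkseq.
case: i => [[f t]|[r t]] /=; split.
- move=> eq_m; have [n tn] := tuple_bound _ t; exists (maxn n m.+1).
  have t_lt k : (tnth t k < maxn n m.+1)%N by rewrite leq_max tn.
  rewrite nth_tuple // size_mkseq nth_mkseq ?leq_maxr//.
  by split; rewrite ?leq_maxr// -eq_m g'K.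
- move=> [n]; rewrite size_mkseq => -[tn mn].
  by rewrite nth_tuple // nth_mkseq // => eq_gm; rewrite eq_gm gK.
- move=> <-; have [n tn] := tuple_bound _ t; exists n.
  by rewrite nth_tuple // size_mkseq.
- by move=> [n]; rewrite size_mkseq => -[tn]; rewrite nth_tuple.
Qed.

Definition elementary_map x y (h : nat -> nat) : Prop :=
  @elementary L (structure_of x) (structure_of y) h.

Lemma elementary_map_uniq x y h p :
  elementary_map x y h -> uniq (map h p) = uniq p.
Proof. by move=> /elementary_inj /map_inj_uniq. Qed.

Lemma forces_atom_prefix x p y h q i m :
  elementary_map x y h -> prefix (map h p) q ->
  forces_atom x p i m -> forces_atom y q i m.
Proof.
move=> /elementary_embedding[_ h_fun h_rel] /prefixP[r ->].
have size_le k : (k < size p)%N -> (k < size (map h p ++ r))%N.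
  by move=> kp; rewrite size_cat size_map ltn_addr.
have nth_h k : (k < size p)%N -> nth 0%N (map h p ++ r) k = h (nth 0%N p k).
  by move=> kp; rewrite nth_cat size_map kp (nth_map 0%N).
have nth_comp n (t : n.-tuple nat) : (forall k, (tnth t k < size p)%N) ->
    (fun k => nth 0%N (map h p ++ r) (tnth t k)) =
    h \o (fun k => nth 0%N p (tnth t k)).
  by move=> tp; apply/funext => k; rewrite nth_h.
case: i => [[f t] [tp mp eq_m]|[R t] [tp <-]] /=.
  split=> [k||]; [exact/size_le/tp|exact: size_le|].
  by rewrite nth_comp // nth_h // -eq_m; exact/esym/h_fun.
split=> [k|]; first exact/size_le/tp.
by rewrite nth_comp //; congr nat_of_bool; exact/esym/h_rel.
Qed.

Variable P : set (model_space L).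

Definition extends x p y q : Prop :=
  exists h, [/\ P y, elementary_map x y h, uniq q & prefix (map h p) q].

Lemma extends_prefix x p q : P x -> uniq q -> prefix p q -> extends x p x q.
Proof. by move=> Px q_uniq pq; exists id; rewrite map_id. Qed.

Lemma extends_elementary x p y h :
  P y -> elementary_map x y h -> uniq p -> extends x p y (map h p).
Proof.
move=> Py h_el p_uniq; exists h; split=> //; last exact: prefix_refl.
by rewrite (elementary_map_uniq _ h_el).
Qed.

Lemma extends_trans x p y q z r :
  extends x p y q -> extends y q z r -> extends x p z r.
Proof.
move=> [h [Py h_el q_uniq pq]] [k [Pz k_el r_uniq qr]]; exists (k \o h).
split=> //; first exact: elementary_comp h_el k_el.
by rewrite map_comp; apply: prefix_trans qr; exact: prefix_map.
Qed.

Fixpoint forces (c : borel_code L) x p : Prop :=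
  match c with
  | CEmpty => False
  | CAtom i m => forces_atom x p i m
  | CNot b => forall y q, extends x p y q -> ~ forces b y q
  | CUnion bs => exists n, forces (bs n) x p
  end.

Lemma forces_extends c x p y q :
  forces c x p -> extends x p y q -> forces c y q.
Proof.
elim: c x p y q => [|i m|b _|bs IH] x p y q //=.
- move=> x_forces [h [_ h_el _ pq]].
  exact: forces_atom_prefix h_el pq x_forces.
- by move=> x_forces xy z r yz; apply: x_forces; exact: extends_trans xy yz.
- by move=> [n x_forces] xy; exists n; exact: IH x_forces xy.
Qed.

Definition decides c x p : Prop := forces c x p \/ forces (CNot c) x p.

Definition generic_enumeration (S : set (borel_code L)) x (g : nat -> nat) :
    Prop :=
  forall c, S c -> exists m, decides c x (mkseq g m).

Lemma truth_lemma c x (g g' : nat -> nat) :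
  P x -> cancel g g' -> cancel g' g ->
  generic_enumeration (negated_subcodes c) x g ->
  denote c (@nat_copy L (structure_of x) g g') <->
  exists m, forces c x (mkseq g m).
Proof.
move=> Px gK g'K.
have extends_mkseq n m : (n <= m)%N -> extends x (mkseq g n) x (mkseq g m).
  move=> nm; apply: extends_prefix (prefix_mkseq _ nm) => //.
  exact/mkseq_uniq/can_inj/gK.
elim: c => [|i m|b IH|bs IH] /= decided.
- by split=> // -[].
- exact: coord_val_nat_copy_forces.
- have {}IH := IH (fun c bc => decided c (or_intror bc)); split.
    move=> not_b; have [m [m_b|m_not_b]] := decided b (or_introl erefl).
      by case: not_b; apply/IH; exists m.
    by exists m.
  move=> [m m_not_b] /IH[n n_b].
  apply: (m_not_b x (mkseq g (maxn m n))); first exact/extends_mkseq/leq_maxl.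
  exact/(forces_extends n_b)/extends_mkseq/leq_maxr.
- have {}IH n := IH n (fun c bc => decided c (ex_intro2 _ _ n I bc)); split.
    by move=> [n _ /IH[m m_bs]]; exists m, n.
  by move=> [m [n m_bs]]; exists n => //; apply/IH; exists m.
Qed.

(* Some sequence forces c over x itself as soon as one does so over some
   elementary extension of x in P. *)
Definition reflects c x p : Prop :=
  forces (CNot c) x p \/ exists q, [/\ uniq q, prefix p q & forces c x q].

Lemma reflects_elementary c x p y h :
  P y -> elementary_map x y h -> uniq p -> reflects c x p ->
  reflects c y (map h p).
Proof.
move=> Py h_el p_uniq [not_c|[q [q_uniq pq q_c]]].
  by left; exact/(forces_extends not_c)/extends_elementary.
right; exists (map h q); split.
- by rewrite (elementary_map_uniq _ h_el).
- exact: prefix_map.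
- exact/(forces_extends q_c)/extends_elementary.
Qed.

Lemma reflects_extension c x p : P x -> uniq p ->
  exists y h, [/\ P y, elementary_map x y h & reflects c y (map h p)].
Proof.
move=> Px p_uniq; have [not_c|] := pselect (forces (CNot c) x p).
  by exists x, id; split=> //; left; rewrite map_id.
move=> /existsNP[y /existsNP[q /not_implyP[]]].
move=> [h [Py h_el q_uniq pq]] /contrapT q_c.
by exists y, h; split=> //; right; exists q.
Qed.

Definition generic_model (S : set (borel_code L)) x : Prop :=
  forall c p, S c -> uniq p -> reflects c x p.

Lemma decides_injective_cofinal S c x :
  generic_model S x -> S c -> injective_cofinal [set q | decides c x q].
Proof.
move=> x_generic Sc q q_uniq.
have [|[r [r_uniq qr r_c]]] := x_generic c q Sc q_uniq.
  by exists q; split=> //; [exact: prefix_refl|right].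
by exists r; split=> //; left.
Qed.

Lemma generic_enumeration_exists (S : set (borel_code L)) x p
    (D : set (set (seq nat))) :
  countable S -> generic_model S x -> uniq p ->
  countable D -> D `<=` injective_cofinal ->
  exists g g' : nat -> nat,
    [/\ cancel g g', cancel g' g, mkseq g (size p) = p,
        generic_enumeration S x g & forall E, D E -> exists m, E (mkseq g m)].
Proof.
move=> S_countable x_generic p_uniq D_countable D_cofinal.
pose decision c : set (seq nat) := [set q | decides c x q].
have [||//|g [g' [gK g'K gp g_meets]]] :=
  @generic_bijection (D `|` decision @` S) p.
- by apply: countableU => //; exact: countable_image.
- move=> E [/D_cofinal //|[c Sc <-]].
  exact: decides_injective_cofinal x_generic Sc.
exists g, g'; split=> // [c Sc|E DE]; apply: g_meets; last by left.
by right; exists c.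
Qed.

Hypothesis P_chains : closed_under_nat_chains P.

Lemma nat_chain_limit (xs : nat -> model_space L) (e : nat -> nat -> nat) :
  (forall n, P (xs n)) ->
  (forall n, elementary_map (xs n) (xs n.+1) (e n)) ->
  exists y (j : nat -> nat -> nat),
    [/\ P y, forall n, elementary_map (xs n) y (j n),
        forall n k, j n.+1 (e n k) = j n k &
        forall i, exists n k, i = j n k].
Proof.
move=> Pxs e_el; have [y Py [j [j_emb je j_surj]]] := P_chains Pxs e_el.
exists y, j; split=> // n.
exact: (elementary_chain_union e_el j_emb je j_surj).
Qed.

Lemma reflects_all_extension (S : set (borel_code L)) x :
  countable S -> P x ->
  exists y h, [/\ P y, elementary_map x y h &
    forall c p, S c -> uniq p -> reflects c y (map h p)].
Proof.
move=> S_countable Px.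
pose mapped_model := (model_space L * (nat -> nat))%type.
pose ext : set mapped_model :=
  [set yh | P yh.1 /\ elementary_map x yh.1 yh.2].
pose le (yh zk : mapped_model) := exists e,
  elementary_map yh.1 zk.1 e /\ zk.2 = e \o yh.2.
pose task (cp : borel_code L * seq nat) : set mapped_model :=
  [set yh | reflects cp.1 yh.1 (map yh.2 cp.2)].
have [|||//|s [s0 s_ext s_le s_task]] := @rasiowa_sikorski _ ext le
    (task @` (S `*` [set p | uniq p])) (x, id).
- by move=> yh _; exists id.
- exact/countable_image/(countableX S_countable)/countableP.
- move=> _ [[c p] /= [_ p_uniq] <-] [y h] /= [Py h_el].
  have [|z [k [Pz k_el z_c]]] := @reflects_extension c y (map h p) Py.
    by rewrite (elementary_map_uniq _ h_el).
  exists (z, k \o h); split; [|by exists k|by rewrite /task /= map_comp].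
  by split=> //; exact: elementary_comp h_el k_el.
have /choice[e eP] := s_le.
have [y [j [Py j_el je _]]] :=
  nat_chain_limit (fun n => (s_ext n).1) (fun n => (eP n).1).
have j_s n : j n \o (s n).2 = j 0%N.
  elim: n => [|n <-]; first by rewrite s0.
  by rewrite (eP n).2; apply/funext => k /=; rewrite je.
exists y, (j 0%N); split=> //; first by have := j_el 0%N; rewrite s0.
move=> c p Sc p_uniq.
have [n n_c] : exists n, task (c, p) (s n).
  by apply: s_task; exact: imageP.
rewrite -(j_s n) map_comp; apply: reflects_elementary n_c => //.
by rewrite (elementary_map_uniq _ (s_ext n).2).
Qed.

Lemma generic_extension (S : set (borel_code L)) x : countable S -> P x ->
  exists y h, [/\ P y, elementary_map x y h & generic_model S y].
Proof.
move=> S_countable Px.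
pose step (u v : {x | P x}) := exists h, elementary_map (sval u) (sval v) h /\
  forall c p, S c -> uniq p -> reflects c (sval v) (map h p).
have step_total u : {v | step u v}.
  apply: cid.
  have [y [h [Py h_el y_S]]] := reflects_all_extension S_countable (svalP u).
  by exists (exist _ y Py), h.
have [xs [xs0 /choice[e eP]]] := dependent_choice step_total (exist _ x Px).
have e_el n := (eP n).1.
have [y [j [Py j_el je j_surj]]] :=
  nat_chain_limit (fun n => svalP (xs n)) e_el.
exists y, (j 0%N); split=> //; first by have := j_el 0%N; rewrite xs0.
move=> c p Sc p_uniq.
have [n [b p_jb]] := chain_common_level e_el je
  (fun i : 'I_(size p) => j_surj (tnth (in_tuple p) i)).
have {p_jb} pE : p = map (j n) (map b (enum 'I_(size p))).
  by rewrite -map_comp -p_jb map_tnth_enum.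
move: (map b _) pE p_uniq => q -> /map_uniq q_uniq.
rewrite -(eq_map (je n)) map_comp; apply: reflects_elementary => //.
  by rewrite (elementary_map_uniq _ (e_el n)).
exact: (eP n).2.
Qed.

End Forcing.

(** * Borel maps and forced values *)

Definition separates_points (J Y : Type) (U : J -> set Y) : Prop :=
  forall y z, (forall i, U i y -> U i z) -> y = z.

Section ForcedValues.
Variables (L : language) (P : set (model_space L)) (Y : Type) (J : countType).
Variables (U : J -> set Y) (f : P -> Y) (code : J -> borel_code L).
Hypothesis P_invariant : isomorphism_invariant P.
Hypothesis U_separates : separates_points U.
Hypothesis code_preimage :
  forall i (z : P), U i (f z) <-> denote (code i) (\val z).

Definition value_codes : set (borel_code L) :=
  \bigcup_i negated_subcodes (CNot (CNot (code i))).

Lemma countable_value_codes : countable value_codes.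
Proof.
by apply: bigcup_countable => // i _; exact: countable_negated_subcodes.
Qed.

(* The double negation is needed because a value that no longer sequence refutes
   is only weakly forced. *)
Definition forces_value (y : Y) (x : model_space L) (p : seq nat) : Prop :=
  forall i, U i y -> forces P (CNot (CNot (code i))) x p.

Definition refutes_value (y : Y) (x : model_space L) (p : seq nat) : Prop :=
  exists2 i, U i y & forces P (CNot (code i)) x p.

Lemma forces_value_elementary y x p w h :
  P w -> elementary_map x w h -> uniq p -> forces_value y x p ->
  forces_value y w (map h p).
Proof.
move=> Pw h_el p_uniq p_y i Uiy.
exact/(forces_extends (p_y i Uiy))/extends_elementary.
Qed.

Lemma forces_or_refutes_value y x p : generic_model P value_codes x -> uniq p ->
  forces_value y x p \/ exists q, [/\ uniq q, prefix p q & refutes_value y x q].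
Proof.
move=> x_generic p_uniq; apply: contrapT => /not_orP[not_forced no_refutation].
apply: not_forced => i Uiy.
have [//|[q [q_uniq pq q_not_i]]] : reflects P (CNot (code i)) x p.
  by apply: x_generic => //; exists i => //; left.
by case: no_refutation; exists q; split=> //; exists i.
Qed.

Lemma nat_copy_value x (g g' : nat -> nat) :
  P x -> cancel g g' -> cancel g' g ->
  generic_enumeration P value_codes x g ->
  exists z : P, [/\ iso_class x (\val z),
    forall y m, forces_value y x (mkseq g m) -> f z = y &
    forall y m, refutes_value y x (mkseq g m) -> f z <> y].
Proof.
move=> Px gK g'K g_generic.
have code_generic i :
    generic_enumeration P (negated_subcodes (CNot (CNot (code i)))) x g.
  by move=> c ci; apply: g_generic; exists i.
have zx := @nat_copy_isomorphic L (structure_of x) g g' gK g'K.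
have Pz := P_invariant Px zx.
pose z : P := exist (fun w => w \in P) _ (mem_set Pz).
exists z; split=> // [y m m_y|y m [i Uiy m_not_i] fz].
  apply/esym/U_separates => i Uiy.
  apply/code_preimage; apply: contrapT => z_not_i.
  have [_] := truth_lemma Px gK g'K (code_generic i).
  by apply => //; exists m; exact: m_y.
have not_code_generic :
    generic_enumeration P (negated_subcodes (CNot (code i))) x g.
  by move=> c ci; apply: (code_generic i); right.
have [_] := truth_lemma Px gK g'K not_code_generic.
by apply; [exists m | apply/(code_preimage i z); rewrite fz].
Qed.

Lemma forced_value_attained y x p :
  P x -> generic_model P value_codes x -> uniq p -> forces_value y x p ->
  exists2 z : P, iso_class x (\val z) & f z = y.
Proof.
move=> Px x_generic p_uniq p_y.
have [g [g' [gK g'K gp g_generic _]]] := generic_enumeration_exists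
  countable_value_codes x_generic p_uniq (countable0 _) (@sub0set _ _).
have [z [zx z_forced _]] := nat_copy_value Px gK g'K g_generic.
by exists z => //; apply: (z_forced y (size p)); rewrite gp.
Qed.

Lemma countable_values_forced x (V : set Y) :
  P x -> generic_model P value_codes x -> countable V ->
  (forall z : P, iso_class x (\val z) -> V (f z)) ->
  exists y p, uniq p /\ forces_value y x p.
Proof.
move=> Px x_generic V_countable V_values; apply: contrapT => no_forced.
pose refutation y : set (seq nat) := [set q | refutes_value y x q].
have [||g [g' [gK g'K _ g_generic g_refutes]]] :=
  @generic_enumeration_exists _ _ _ _ [::] (refutation @` V)
    countable_value_codes x_generic isT.
- exact: countable_image.
- move=> _ [y Vy <-] q q_uniq.
  have [q_y|//] := forces_or_refutes_value y x_generic q_uniq.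
  by case: no_forced; exists y, q.
have [z [zx _ z_not]] := nat_copy_value Px gK g'K g_generic.
have [m m_refutes] := g_refutes _ (imageP refutation (V_values z zx)).
exact: z_not m_refutes erefl.
Qed.

Lemma new_type_equal_values :
  closed_under_nat_chains P -> type_extendible P -> P !=set0 ->
  (forall x, P x -> countable (f @` [set z | iso_class x (\val z)])) ->
  exists z w : P, f z = f w /\
    realizes_new_type (structure_of (\val z)) (structure_of (\val w)).
Proof.
move=> P_chains P_ext [x0 Px0] f_countable.
have [x [_ [Px _ x_generic]]] :=
  generic_extension P_chains countable_value_codes Px0.
have [y [p [p_uniq p_y]]] := countable_values_forced Px x_generic
  (f_countable x Px) (fun z zx => imageP f zx).
have [x1 [Px1 [h h_el] new_type]] := P_ext x Px.
have [x2 [k [Px2 k_el x2_generic]]] :=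
  generic_extension P_chains countable_value_codes Px1.
have kh_el : elementary_map x x2 (k \o h) by exact: elementary_comp h_el k_el.
have kh_y := forces_value_elementary Px2 kh_el p_uniq p_y.
have [z zx fz] := forced_value_attained Px x_generic p_uniq p_y.
have [|w wx2 fw] := forced_value_attained Px2 x2_generic _ kh_y.
  by rewrite (elementary_map_uniq _ kh_el).
exists z, w; split; first by rewrite fz fw.
have [i i_el] := isomorphic_elementary zx.
have [j j_el] := isomorphic_elementary (isomorphic_sym wx2).
exact: realizes_new_type_elementary i_el (elementary_comp k_el j_el) new_type.
Qed.

End ForcedValues.

Lemma borel_map_new_type_equal_values (L : language) (P : set (model_space L))
    (Y : topologicalType) (J : countType) (U : J -> set Y) (f : P -> Y) :
  isomorphism_invariant P -> closed_under_nat_chains P -> type_extendible P ->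
  P !=set0 ->
  (forall i, open (U i)) -> separates_points U -> borel_map f ->
  (forall x, P x -> countable (f @` [set z | iso_class x (\val z)])) ->
  exists z w : P, f z = f w /\
    realizes_new_type (structure_of (\val z)) (structure_of (\val w)).
Proof.
move=> P_invariant P_chains P_ext P_nonempty U_open U_separates f_borel.
have /choice[code codeP] i :
    exists c, f @^-1` U i = [set z | denote c (\val z)].
  by apply: borel_coded; apply: f_borel; apply: sub_gen_smallest; exact: U_open.
apply: (@new_type_equal_values _ _ _ _ U f code) => // i z.
by have := congr1 (@^~ z) (codeP i) => /= ->.
Qed.

Lemma polish_separating_opens (R : realType) (Y : completePseudoMetricType R) :
  polish Y -> exists2 U : nat * nat -> set Y,
    (forall i, open (U i)) & separates_points U.
Proof.
move=> [Y_hausdorff [D /ocard_geP[d] D_dense]].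
pose small_ball c k : set Y := (ball c (k.+1%:R^-1 : R)%R)°.
exists (fun ik => if d ik.1 is Some c then small_ball c ik.2 else set0).
  by move=> [i k] /=; case: (d i) => [c|]; [exact: open_interior|exact: open0].
move=> y z sep; apply: Y_hausdorff => A B /nbhs_ballP[e /= e0 eA] nB.
exists z; split; last exact: nbhs_singleton.
have [k] := ltr_add_invr (divr_gt0 e0 (ltr0n _ 2)).
rewrite add0r; set r := (k.+1%:R^-1 : R)%R => re.
have r0 : (0 < r)%R by rewrite invr_gt0.
have r20 : (0 < r / 2)%R by rewrite divr_gt0.
have [||c [yc Dc]] := D_dense (ball y (r / 2)%R)°.
- by exists y; exact: nbhsx_ballx.
- exact: open_interior.
have {}yc := interior_subset yc.
have [i _ di] := @surj _ _ _ _ d (Some c) (imageP Some Dc).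
have := sep (i, k); rewrite /= di => sep_c.
have cz : ball c r z.
  apply: interior_subset; apply: sep_c.
  apply/nbhs_ballP; exists (r / 2)%R => // w yw.
  by apply: ball_split yw; exact: ball_sym.
apply: eA; apply: le_ball (ball_triangle yc cz).
lra.
Qed.

Theorem theorem4p3 (R : realType) (L : language) (sigma : sentence L)
    (C : structure L -> Prop)
    (C_models : forall K, C K -> countable_model sigma K)
    (C_iso : closed_under_isomorphism C)
    (C_nonempty : exists K, C K)
    (C_ext : forall K, C K ->
       exists M : structure L,
         [/\ C M, exists h : K -> M, elementary h & realizes_new_type K M])
    (C_chains : closed_under_elementary_chains C) :
  ~ essentially_countable R (@iso_on L C).
Proof.
move=> [Y [F [Y_polish [_ _ F_countable] [[f [f_borel f_red]] _]]]].
have [U U_open U_separates] := polish_separating_opens Y_polish.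
have [|x Cx|z [w [fzw new_type]]] := borel_map_new_type_equal_values
  (space_of_isomorphism_invariant C_iso)
  (space_of_closed_under_nat_chains C_models C_iso C_ext C_chains)
  (space_of_type_extendible C_models C_iso C_ext) _ U_open U_separates f_borel.
- have [K CK] := C_nonempty.
  by have [x Cx _] := class_nat_copy C_models C_iso C_ext CK; exists x.
- pose zx : space_of C := exist (fun w => w \in space_of C) x (mem_set Cx).
  apply: sub_countable (F_countable (f zx)); apply: subset_card_le.
  by move=> _ [z zx_iso <-]; apply/f_red/isomorphic_sym.
- apply: isomorphic_no_new_type new_type.
  by apply/(f_red z w); rewrite -fzw; apply/(f_red z z)/isomorphic_refl.
Qed.
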